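(* For every graph $G$, $\gamma_{rR}(G)<\gamma_{rdR}(G)$.
   Context: All graphs are finite and simple (with nonempty vertex set). A restrained double Roman dominating function (RDRD function) of a graph $G$ is a function $f:V(G)\to\{0,1,2,3\}$ such that, with $V_i=\{v\in V(G): f(v)=i\}$: (a) every vertex $v\in V_0$ has at least two neighbors in $V_2$ or at least one neighbor in $V_3$; (b) every vertex $v\in V_1$ has at least one neighbor in $V_2\cup V_3$; (c) the induced subgraph $G[V_0]$ has no isolated vertex. The weight of $f$ is $\sum_{v\in V(G)} f(v)$, and $\gamma_{rdR}(G)$ is the minimum weight of an RDRD function of $G$. A restrained Roman dominating function of $G$ is a function $g:V(G)\to\{0,1,2\}$ such that every vertex $v$ with $g(v)=0$ has a neighbor $w$ with $g(w)=2$, and the subgraph induced by $\{v: g(v)=0\}$ has no isolated vertex. $\gamma_{rR}(G)$ is the minimum weight $\sum_{v} g(v)$ of such a function. *)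

(* Defs.v *)
From mathcomp Require Import all_boot.
Set Implicit Arguments.
Unset Strict Implicit.
Unset Printing Implicit Defensive.

(* A finite simple graph is a symmetric irreflexive relation [e] on a finType;
   these two conditions, and nonemptiness, are hypotheses of the theorem and
   not built into the definitions below. *)
Section RestrainedDomination.

Variables (T : finType) (e : rel T).

Definition neighbors (v : T) : {set T} := [set w | e v w].

Definition no_isolated (A : {set T}) : bool :=
  [forall v in A, neighbors v :&: A != set0].

Definition level k (f : {ffun T -> 'I_k}) (i : nat) : {set T} :=
  [set v | f v == i :> nat].

Definition weight k (f : {ffun T -> 'I_k}) : nat := \sum_v (f v : nat).

Definition RDRD_function (f : {ffun T -> 'I_4}) : bool :=
  [&& [forall v in level f 0,
         (2 <= #|neighbors v :&: level f 2|) ||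
         (1 <= #|neighbors v :&: level f 3|)],
      [forall v in level f 1,
         1 <= #|neighbors v :&: (level f 2 :|: level f 3)|]
    & no_isolated (level f 0)].

Definition RRD_function (g : {ffun T -> 'I_3}) : bool :=
  [forall v in level g 0, [exists w in neighbors v, g w == 2 :> nat]]
  && no_isolated (level g 0).

Lemma RDRD_const2 : RDRD_function [ffun=> inord 2].
Proof.
by apply/and3P; split; apply/forallP => v; rewrite inE ffunE inordK.
Qed.

Lemma RRD_const2 : RRD_function [ffun=> inord 2].
Proof.
by apply/andP; split; apply/forallP => v; rewrite inE ffunE inordK.
Qed.

(* [arg min] takes the constant function 2 as a witness that the set of
   admissible functions is nonempty; it does not affect the minimum. *)
Definition gamma_rdR : nat :=
  weight [arg min_(f < [ffun=> inord 2] | RDRD_function f) weight f].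

Definition gamma_rR : nat :=
  weight [arg min_(g < [ffun=> inord 2] | RRD_function g) weight g].

Lemma gamma_rdRP :
  (exists2 f, RDRD_function f & weight f = gamma_rdR) /\
  (forall f, RDRD_function f -> gamma_rdR <= weight f).
Proof.
rewrite /gamma_rdR; case: arg_minnP => [|f Pf minf]; first exact: RDRD_const2.
by split => //; exists f.
Qed.

Lemma gamma_rRP :
  (exists2 g, RRD_function g & weight g = gamma_rR) /\
  (forall g, RRD_function g -> gamma_rR <= weight g).
Proof.
rewrite /gamma_rR; case: arg_minnP => [|g Pg ming]; first exact: RRD_const2.
by split => //; exists g.
Qed.

End RestrainedDomination.

(* Main.v *)
Require Import Defs.
From mathcomp Require Import all_boot.

(** Take an RDRD function f of minimum weight. If some vertex has value 3,
    lower all values 3 to 2. Otherwise some vertex w has value 2, and every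
    vertex of value 0 has two neighbors of value 2, hence one besides w; so
    lower f w to 1. Either way the zero set is unchanged and the result is a
    restrained Roman dominating function of smaller weight. *)

(** Both ways of lowering [f] go through this criterion. The bounds force [g] to vanish exactly
    where [f] does, so its zero set inherits the absence of isolated vertices; the drop at [w] makes
    the inequality strict. *)
Lemma gamma_rR_lt_weight (T : finType) (e : rel T)
    (f : {ffun T -> 'I_4}) (g : T -> nat) (w : T) :
    RDRD_function e f ->
    (forall v, g v <= minn (f v) 2) -> g w < f w ->
    (forall v, f v != 0 :> nat -> 0 < g v) ->
    (forall v, f v = 0 :> nat -> exists2 u, e v u & g u = 2) ->
  gamma_rR e < weight f.
Proof.
move=> /and3P[_ _ iso0] le_g lt_w g_gt0 dom.
(* The cast by [inord] loses nothing, since [g v] is at most 2. *)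
pose h : {ffun T -> 'I_3} := [ffun v => inord (g v)].
have hE v : h v = g v :> nat.
  by rewrite ffunE inordK // ltnS (leq_trans (le_g v)) ?geq_minr.
have le_gf v : g v <= f v by rewrite (leq_trans (le_g v)) ?geq_minl.
have level0 : level h 0 = level f 0.
  apply/setP=> v; rewrite !inE hE; apply/idP/idP => [|/eqP f0].
    by apply: contraTT => /g_gt0; rewrite lt0n.
  by rewrite -leqn0 -f0.
have hP : RRD_function e h.
  rewrite /RRD_function level0 iso0 andbT.
  apply/'forall_implyP=> v; rewrite inE => /eqP/dom[u evu gu].
  by apply/existsP; exists u; rewrite inE evu hE gu.
apply: leq_ltn_trans ((gamma_rRP e).2 h hP) _.
rewrite /weight (bigD1 w) //= [X in _ < X](bigD1 w) //= hE -addSn.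
by rewrite leq_add // leq_sum // => v _; rewrite hE.
Qed.

(** Any vertex of value 0 or 1 must have a neighbor of value 2 or 3. *)
Lemma RDRD_ge2 (T : finType) (e : rel T) (f : {ffun T -> 'I_4}) :
  RDRD_function e f -> 0 < #|T| -> exists w, 1 < f w.
Proof.
move=> /and3P[/'forall_implyP dom0 /'forall_implyP dom1 _] /card_gt0P[v _].
case Dv: (nat_of_ord (f v)) => [|[|k]]; last by exists v; rewrite Dv.
- have := dom0 v; rewrite inE Dv => /(_ isT)/orP[/ltnW|].
    by case/card_gt0P=> u; rewrite !inE => /andP[_ /eqP fu]; exists u; rewrite fu.
  by case/card_gt0P=> u; rewrite !inE => /andP[_ /eqP fu]; exists u; rewrite fu.
- have := dom1 v; rewrite inE Dv => /(_ isT)/card_gt0P[u].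
  by rewrite !inE => /andP[_ /orP[]/eqP fu]; exists u; rewrite fu.
Qed.

Theorem theorem14 (T : finType) (e : rel T)
  (e_sym : symmetric e) (e_irr : irreflexive e) (T_nonempty : 0 < #|T|) :
  gamma_rR e < gamma_rdR e.
Proof.
have [[f fP <-] _] := gamma_rdRP e.
have /and3P[/'forall_implyP dom0 _ _] := fP.
have [/existsP[w /eqP fw]|/existsPn no3] := boolP [exists w, f w == 3 :> nat].
  apply: (@gamma_rR_lt_weight _ e f (fun v => minn (f v) 2) w) => // [|v|v fv].
  - by rewrite fw.
  - by rewrite leq_min lt0n andbT.
  (* One neighbor of value 2 or 3 suffices, as [minn] sends both values to 2. *)
  - have := dom0 v; rewrite inE fv => /(_ isT)/orP[/ltnW|] /card_gt0P[u];
    by rewrite !inE => /andP[evu /eqP fu]; exists u; rewrite ?fu.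
have le2 v : f v <= 2.
  by have := ltn_ord (f v); have := no3 v; rewrite ltnS leq_eqVlt => /negPf->.
have [w fw] := RDRD_ge2 _ _ _ fP T_nonempty.
apply: (@gamma_rR_lt_weight _ e f (fun v => if v == w then 1 else f v) w)
  => // [v||v|v fv].
- by case: eqP => [->|_]; rewrite leq_min ?le2 ?leqnn // ltnW.
- by rewrite eqxx.
- by rewrite -lt0n; case: eqP.
have := dom0 v; rewrite inE fv => /(_ isT)/orP[|/card_gt0P[u]]; last first.
  by rewrite !inE (negPf (no3 u)) andbF.
(* [w] is at most one of the two neighbors of value 2, so another one remains, whose value is
   unchanged. *)
rewrite (cardsD1 w) => two.
have /card_gt0P[u] : 0 < #|(neighbors e v :&: level f 2) :\ w|.
  by move: two; case: (w \in _) => // /ltnW.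
rewrite !inE => /and3P[/negPf uw evu /eqP fu].
by exists u; rewrite ?uw.
Qed.
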